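(* Let $g$ be a positive increasing function on $[0,\infty)$ with $g(\infty)=\lim_{x\to\infty}g(x)=\infty$. In the unbounded forecasting game Skeptic can force the event $$\sum_n v_n=\infty\ \text{ and }\ \sum_n\frac{v_n}{g(A_n)}<\infty\ \Rightarrow\ \frac{\sum_{k\le n}(x_k-m_k)}{\sqrt{g(A_n)}}\to0,$$ where $A_n=\sum_{k=1}^n v_k$.
   Context: Unbounded forecasting game: $\mathcal K_0=1$. For $n=1,2,\ldots$: Forecaster announces $m_n\in\mathbb R$ and $v_n>0$; Skeptic announces $M_n\in\mathbb R$ and $V_n\ge0$; Reality announces $x_n\in\mathbb R$; and $\mathcal K_n:=\mathcal K_{n-1}+M_n(x_n-m_n)+V_n((x_n-m_n)^2-v_n)$. All moves are public. A path is an infinite sequence $\xi=(m_1,v_1,x_1,m_2,v_2,x_2,\ldots)$ of allowed moves of Forecaster and Reality; $\Xi$ is the set of paths; an event is any subset of $\Xi$. A strategy $\mathcal P$ of Skeptic specifies his allowed move $(M_n,V_n)$ at each round $n$ as a function of $m_1,v_1,x_1,\ldots,m_{n-1},v_{n-1},x_{n-1},m_n,v_n$. Its capital process is $\mathcal K^{\mathcal P}_0=0$, $\mathcal K^{\mathcal P}_n=\mathcal K^{\mathcal P}_{n-1}+M_n(x_n-m_n)+V_n((x_n-m_n)^2-v_n)$ with $(M_n,V_n)$ given by $\mathcal P$. Skeptic can force an event $E$ if there is a strategy $\mathcal P$ such that $\mathcal K^{\mathcal P}_n(\xi)\ge-1$ for all $\xi\in\Xi$, $n\ge0$, and $\limsup_n\mathcal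 K^{\mathcal P}_n(\xi)=\infty$ for every $\xi\notin E$. For events, $E_1\Rightarrow E_2$ denotes $E_1^c\cup E_2$. *)

(* Defs.v *)
From HB Require Import structures.
From mathcomp Require Import all_boot all_order all_algebra.
From mathcomp Require Import all_classical all_reals all_analysis.

Set Implicit Arguments.
Unset Strict Implicit.
Unset Printing Implicit Defensive.

Import Order.TTheory GRing.Theory Num.Theory.
Import numFieldNormedType.Exports.

Local Open Scope classical_set_scope.
Local Open Scope ring_scope.

Section unbounded_forecasting_game.
Variable R : realType.

Record forecast := Forecast { fmean : R ; fvar : {posnum R} }.

Record bet := Bet { bet_lin : R ; bet_quad : {nonneg R} }.

Record round := Round { announced : forecast ; outcome : R }.

(* Rounds are numbered from 0: [xi n] is the triple (m_(n+1), v_(n+1), x_(n+1)). *)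
Definition game_path := nat -> round.

Definition forecast_mean (xi : game_path) (n : nat) : R := fmean (announced (xi n)).

Definition forecast_var (xi : game_path) (n : nat) : R := (fvar (announced (xi n)))%:num.

Definition outcome_at (xi : game_path) (n : nat) : R := outcome (xi n).

(* The list contains the completed rounds, oldest first; its length determines
   the current round. *)
Definition strategy := seq round -> forecast -> bet.

Definition bet_at (P : strategy) (xi : game_path) (n : nat) : bet :=
  P (mkseq xi n) (announced (xi n)).

Fixpoint capital (P : strategy) (xi : game_path) (n : nat) : R :=
  if n is k.+1 then
    capital P xi k
    + bet_lin (bet_at P xi k) * (outcome_at xi k - forecast_mean xi k)
    + (bet_quad (bet_at P xi k))%:num
      * ((outcome_at xi k - forecast_mean xi k) ^+ 2 - forecast_var xi k)
  else 0.

Definition event := set game_path.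

Definition can_force (E : event) : Prop :=
  exists P : strategy,
    (forall xi n, -1 <= capital P xi n) /\
    (forall xi, ~ E xi -> limn_esup (fun n => (capital P xi n)%:E) = +oo%E).

Definition event_impl (E1 E2 : event) : event := ~` E1 `|` E2.

(* A_n, the sum over the first n rounds; A_0 = 0. *)
Definition cumvar (xi : game_path) (n : nat) : R := \sum_(k < n) forecast_var xi k.

End unbounded_forecasting_game.

(* Main.v *)
Require Import Defs.
From HB Require Import structures.
From mathcomp Require Import all_boot all_order all_algebra.
From mathcomp Require Import all_classical all_reals all_analysis.
From mathcomp Require Import lra ring.

(** Write [S_n] for the sum of the first [n] deviations [x_k - m_k], and [W_n]
for the sum of the first [n] terms [v_k / g (A_k)].  If [b_n] is a positive
nondecreasing norming sequence known one round ahead, then betting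
[2 S_n / b_(n+1)] linearly and [1 / b_(n+1)] quadratically in the next round
brings in
  [(U_(n+1) - U_n) + U_n (1 - b_n / b_(n+1)) - v / b_(n+1)]
where [U_n = S_n^2 / b_n] and [v] is the variance announced for that round.
So Skeptic holds an asset of price [U_n >= 0], collects a nonnegative income
[U_n (1 - b_n / b_(n+1))], and pays a fee [v / b_(n+1)].

The choice [b_n = g (A_n) (1 + W_n)^2] makes the fees affordable on all paths at
once: by telescoping, the fee is at most
[1 / (1 + W_n) - 1 / (1 + W_(n+1))], so that the fees never add up to more than 1
([reserve_pays]).  When [W] is bounded, [b_n] and [g (A_n)] are of the same order,
and the claim becomes [U_n -> 0].

Skeptic mixes countably many ways of trading this asset.
- One part of the money holds it forever.  If its capital stays bounded, the
  total income is finite; as [b_n -> oo], this is only possible if [U_n] comes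
  arbitrarily close to 0 infinitely often ([bounded_income_low]).
- For each level [e = 2^-(j+3)], a further part buys when [U_n <= e] and sells
  when [U_n >= 2 e], as in the proof of Doob's convergence theorem.  It never loses
  more than [e] and the fees, and earns [e] at each sale ([upcrossing_gain]).  If
  its capital stays bounded, the number of sales is finite, so that [U_n], which
  returns below [e] again and again, is eventually below [2 e]
  ([sales_unbounded]).
All parts make the same bet up to a factor 0 or 1, and level [j] starts trading
only in round [j], so the mixture is a finite weighted sum in each round.  Hence on
a path where the mixture's capital is bounded above and the hypotheses on the
variances hold, [U_n -> 0]; on a path violating the event the capital
is therefore unbounded, and its upper limit is infinite. *)

Set Implicit Arguments.
Unset Strict Implicit.
Unset Printing Implicit Defensive.

Import Order.TTheory GRing.Theory Num.Theory.
Import numFieldNormedType.Exports.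

Local Open Scope classical_set_scope.
Local Open Scope ring_scope.

(** * Unbounded real sequences *)

Section unbounded_sequences.
Variable R : realType.

Lemma unbounded_of_steps (f : nat -> R) (c : R) : 0 < c ->
  (forall m, exists n, f m + c <= f n) -> forall B, exists n, B < f n.
Proof.
move=> c0 step B.
have climb i : exists n, f 0%N + c *+ i <= f n.
  elim: i => [|i [m Hm]]; first by exists 0%N; rewrite mulr0n addr0.
  have [n Hn] := step m; exists n.
  by rewrite mulrSr addrA; apply: le_trans Hn; rewrite lerD2r.
have [n Hn] := climb (Num.bound `|(B - f 0%N) / c|).
exists n; apply: lt_le_trans Hn.
have : `|(B - f 0%N) / c| < (Num.bound `|(B - f 0%N) / c|)%:R by exact: archi_boundP.
move=> /(le_lt_trans (ler_norm _)).
by rewrite ltr_pdivrMr // mulrC mulr_natr; lra.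
Qed.

(** Each tail of a real sequence unbounded above is itself unbounded above, since
the finitely many terms before the tail are bounded. *)
Lemma limn_esup_unbounded (u : nat -> R) :
  (forall B, exists n, B < u n) -> limn_esup (fun n => (u n)%:E) = +oo%E.
Proof.
move=> unb.
suff H : esups (fun n => (u n)%:E) = fun=> +oo%E.
  by rewrite limn_esup_lim H lim_cst.
apply/funext => m; apply/eqyP => A A0.
have [n Hn] := unb (A + \sum_(k < m) `|u k|).
have sum0 : 0 <= \sum_(k < m) `|u k| by apply: sumr_ge0.
apply: (@le_trans _ _ (u n)%:E); first by rewrite lee_fin; lra.
apply: ereal_sup_ubound; exists n => //=.
rewrite leqNgt; apply/negP => nm.
suff : `|u n| <= \sum_(k < m) `|u k| by have := ler_norm (u n); lra.
by rewrite (bigD1 (Ordinal nm)) //= lerDl sumr_ge0.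
Qed.

End unbounded_sequences.

(** * Buying low and selling high *)

Section upcrossings.
Variables (R : realType) (U : nat -> R) (start : nat) (e : R).

(** A trader in an asset of price [U] who may not buy before time [start]; [holding n]
tells whether the asset is held during the step from [n] to [n.+1], so it must
only look at [U 0 .. U n]. *)
Fixpoint holding n : bool :=
  if n is k.+1 then
    if holding k then U k.+1 < 2 * e else (start <= k.+1)%N && (U k.+1 <= e)
  else false.

Fixpoint sales n : nat :=
  if n is k.+1 then (sales k + (holding k && ~~ holding k.+1))%N else 0%N.

Lemma holding_start n : (n < start)%N -> holding n = false.
Proof.
elim: n => [//|n IH] Hn /=.
by rewrite (IH (ltnW Hn)) leqNgt Hn.
Qed.

Lemma holding_low n : 0 < e -> (0 < n)%N -> (start <= n)%N -> U n <= e -> holding n.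
Proof.
move=> e0; case: n => // n _ Hs HU /=; case: ifP => _; last by rewrite Hs HU.
by lra.
Qed.

Lemma holding_high n : 0 < e -> 2 * e <= U n -> ~~ holding n.
Proof.
move=> e0; case: n => // n HU /=; case: ifP => _; first by rewrite -leNgt.
by rewrite negb_and -ltNge orbC; apply/orP; left; lra.
Qed.

Lemma sales_mono m n : (m <= n)%N -> (sales m <= sales n)%N.
Proof.
elim: n => [|n IH]; first by rewrite leqn0 => /eqP ->.
rewrite leq_eqVlt => /orP[/eqP -> //|]; rewrite ltnS => /IH /leq_trans; apply.
by rewrite /= leq_addr.
Qed.

Lemma sales_lt m n : (m <= n)%N -> holding m -> ~~ holding n -> (sales m < sales n)%N.
Proof.
elim: n => [|n IH]; first by rewrite leqn0 => /eqP ->.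
rewrite leq_eqVlt => /orP[/eqP -> -> //|]; rewrite ltnS => mn hm hn.
rewrite /= -/(holding n.+1) hn andbT.
case: (boolP (holding n)) => [_|nh]; last by rewrite addn0; exact: IH.
by rewrite addn1 ltnS; exact: sales_mono.
Qed.

(** After each time the price is once low, which ensures that the asset is held, and
later high, which ensures that it is not: a sale took place in between. *)
Lemma sales_unbounded : 0 < e ->
  (forall m, exists2 n, (m <= n)%N & U n <= e) ->
  (forall m, exists2 n, (m <= n)%N & 2 * e <= U n) ->
  forall B : R, exists n, B < (sales n)%:R.
Proof.
move=> e0 low high; apply: (@unbounded_of_steps _ _ 1) => // m.
have [a Ha Ua] := low (maxn m (maxn start 1)).
move: Ha; rewrite !geq_max => /and3P[ma sa a0].
have [b ab Ub] := high a; exists b.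
rewrite natr1 ler_nat; apply: leq_ltn_trans (sales_mono ma) _.
by apply: sales_lt => //; [exact: holding_low | exact: holding_high].
Qed.

(** Each completed purchase and sale raises the price by at least [2 e - e = e]; the open
position, bought at a price of at most [e] and still worth [U n], accounts for
the term [U n - e].  The fees [H k - H k.+1] telescope, and paying them also
while nothing is held only lowers the bound. *)
Lemma upcrossing_gain (X H : nat -> R) n :
  0 < e -> (forall k, H k.+1 <= H k) ->
  (forall k, (U k.+1 - U k) + (H k.+1 - H k) <= X k) ->
  e * (sales n)%:R + (if holding n then U n - e else 0) + (H n - H 0%N)
    <= \sum_(k < n) (holding k)%:R * X k.
Proof.
move=> e0 Hdecr HX; elim: n => [|n IH]; first by rewrite big_ord0 /=; lra.
rewrite big_ord_recr /= natrD; have := HX n; have := Hdecr n; move: IH.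
set s : R := (sales n)%:R; set T := \sum_(_ < n) _.
case: (holding n) => /=.
  by case: (ltP (U n.+1) (2 * e)) => HU /=; rewrite mulrDr; lra.
by case: (leqP start n.+1) => _ /=; [case: (leP (U n.+1) e) => HU /=|]; rewrite mulrDr; lra.
Qed.

End upcrossings.

Lemma eq_holding (R : realType) (U U' : nat -> R) start e n :
  (forall k, (k <= n)%N -> U k = U' k) -> holding U start e n = holding U' start e n.
Proof.
elim: n => [//|n IH] eqU /=; rewrite eqU // IH // => k kn.
by apply: eqU; exact: leqW.
Qed.

(** * Income from a growing norming sequence *)

Section norming_income.
Variables (R : realType) (b U : nat -> R).
Hypothesis b_gt0 : forall n, 0 < b n.
Hypothesis b_incr : forall n, b n <= b n.+1.
Hypothesis b_unbounded : forall B, exists n, B <= b n.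
Hypothesis U_ge0 : forall n, 0 <= U n.

Let income n := \sum_(k < n) U k * (1 - b k / b k.+1).

Let ratio_le1 k : b k / b k.+1 <= 1.
Proof. by rewrite ler_pdivrMr ?mul1r. Qed.

(* While [e <= U], the sum from [m] to [n] of [e (1 - q_k)], with [q_k = b k / b k.+1],
   is at least [e (1 - p)] where [p] is the product of the [q_k], that is
   [b m / b n]; the induction step is [(1 - p) (1 - q) >= 0]. *)
Let income_ge (e : R) m n : 0 < e -> (forall k, (m <= k)%N -> e <= U k) -> (m <= n)%N ->
  income m + e * (1 - b m / b n) <= income n.
Proof.
move=> e0 HU; elim: n => [|n IH].
  by rewrite leqn0 => /eqP ->; rewrite divff ?gt_eqF// subrr mulr0 addr0.
rewrite leq_eqVlt => /orP[/eqP ->|].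
  by rewrite divff ?gt_eqF// subrr mulr0 addr0.
rewrite ltnS => mn; rewrite /income big_ord_recr /= -/(income n) -/(income m).
have := IH mn.
have b_mono : b m <= b n by apply: (homo_leq (@lexx _ _) (@le_trans _ _) b_incr).
have p1 : b m / b n <= 1 by rewrite ler_pdivrMr ?mul1r.
have q1 := ratio_le1 n.
have -> : b m / b n.+1 = (b m / b n) * (b n / b n.+1).
  by rewrite mulrA divfK ?gt_eqF.
set p := b m / b n in p1 *; set q := b n / b n.+1 in q1 *; move=> L.
have Un := HU n mn.
have h1 : 0 <= (U n - e) * (1 - q) by apply: mulr_ge0; lra.
have h2 : 0 <= e * ((1 - p) * (1 - q)) by apply: mulr_ge0; [lra|apply: mulr_ge0; lra].
by nra.
Qed.

(** If [U] stayed above [e], then every time [b] doubles the sum would grow by at least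
[e / 2], by [income_ge]. *)
Lemma bounded_income_low (B e : R) : 0 < e -> (forall n, income n <= B) ->
  forall m, exists2 n, (m <= n)%N & U n <= e.
Proof.
move=> e0 incomeB m; apply: contrapT => nlow.
have HU k : (m <= k)%N -> e <= U k.
  by move=> mk; rewrite leNgt; apply/negP => Uk; apply: nlow; exists k => //; exact: ltW.
have income_incr p q : (p <= q)%N -> income p <= income q.
  apply: (homo_leq (@lexx _ _) (@le_trans _ _)) => k.
  rewrite /income big_ord_recr /= lerDl mulr_ge0 //.
  by have := ratio_le1 k; lra.
suff step p : exists n, income p + e / 2 <= income n.
  have [|n] := unbounded_of_steps _ step B; first by lra.
  by rewrite ltNge incomeB.
have [n Hn] := b_unbounded (2 * b (maxn p m)).
set r := maxn p m in Hn.
have rn : (r <= n)%N.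
  rewrite leqNgt; apply/negP => /ltnW nr.
  have : b n <= b r by apply: (homo_leq (@lexx _ _) (@le_trans _ _) b_incr).
  by have := b_gt0 r; lra.
exists n; apply: le_trans (income_ge (m := r) e0 _ rn); last first.
  by move=> k rk; apply: HU; apply: leq_trans rk; exact: leq_maxr.
have := income_incr p r (leq_maxl _ _).
have : b r / b n <= 2^-1 by rewrite ler_pdivrMr //; lra.
by set q := b r / b n; set lp := income p; set lr := income r => h1 h2; nra.
Qed.

End norming_income.

(** * Predictable bets *)

Section predictable_bets.
Variable R : realType.

Definition predictable T (F : game_path R -> nat -> T) := forall xi xi' n,
  (forall k, (k < n)%N -> xi k = xi' k) -> announced (xi n) = announced (xi' n) ->
  F xi n = F xi' n.

(** A strategy sees a finite history and the new forecast, while the bets below are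
written as functions of the whole path.  The history is completed to a path by
a constant round that carries the forecast and a dummy outcome, so that round
[size h] has the right announcement. *)
Definition strategy_of (F : game_path R -> nat -> bet R) : strategy R :=
  fun h f => F (nth (Round f 0) h) (size h).

Lemma bet_at_strategy_of F xi n : predictable F -> bet_at (strategy_of F) xi n = F xi n.
Proof.
move=> predF; rewrite /bet_at /strategy_of size_mkseq; apply: predF => [k kn|].
  by rewrite nth_mkseq.
by rewrite nth_default // size_mkseq.
Qed.

Lemma capital_sum (P : strategy R) xi n :
  capital P xi n = \sum_(k < n)
    (bet_lin (bet_at P xi k) * (outcome_at xi k - forecast_mean xi k)
     + (bet_quad (bet_at P xi k))%:num
       * ((outcome_at xi k - forecast_mean xi k) ^+ 2 - forecast_var xi k)).
Proof.
elim: n => [|n IH]; first by rewrite big_ord0.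
by rewrite big_ord_recr -IH /= addrA.
Qed.

End predictable_bets.

(** * The strategy *)

Section strong_law.
Variables (R : realType) (g : R -> R).
Hypothesis g_gt0 : forall x : R, 0 <= x -> 0 < g x.
Hypothesis g_incr : forall x y : R, 0 <= x -> x <= y -> g x <= g y.
Implicit Types xi : game_path R.

Definition surplus xi n : R := \sum_(k < n) (outcome_at xi k - forecast_mean xi k).

Definition scaled_var xi n : R :=
  \sum_(k < n) forecast_var xi k / g (cumvar xi k.+1).

(** The factor [(1 + W_n)^2] bounds the total fee by 1 on every path, see
[reserve_pays]. *)
Definition norming xi n : R := g (cumvar xi n) * (1 + scaled_var xi n) ^+ 2.

Definition energy xi n : R := surplus xi n ^+ 2 / norming xi n.

(** What is left, of an initial 1, for paying fees. *)
Definition reserve xi n : R := (1 + scaled_var xi n)^-1.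

(** Both the price level of the [j]-th trader and the weight of that trader in the
mixture.  As each of these traders risks at most [scale j + 1 <= 2] and the
weights sum up to [1 / 4], together they risk at most [1 / 2], which leaves a
weight of [1 / 2] for holding the asset forever. *)
Definition scale (j : nat) : R := (2 ^+ (j + 3))^-1.

(** Terms with [n < j] would vanish, by [holding_start]. *)
Definition stake xi n : R :=
  2^-1 + \sum_(j < n.+1) scale j * (holding (energy xi) j (scale j) n)%:R.

Definition unit_gain xi n : R :=
  2 * surplus xi n / norming xi n.+1 * (outcome_at xi n - forecast_mean xi n)
  + (norming xi n.+1)^-1
    * ((outcome_at xi n - forecast_mean xi n) ^+ 2 - forecast_var xi n).

Lemma scale_gt0 j : 0 < scale j.
Proof. by rewrite invr_gt0 exprn_gt0. Qed.

Lemma scaleS j : scale j.+1 = scale j / 2.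
Proof. by rewrite /scale addSn exprS invfM mulrC. Qed.

Lemma scale_le j : scale j <= 8^-1.
Proof.
elim: j => [|j IH]; first by rewrite /scale add0n; lra.
by rewrite scaleS; have := scale_gt0 j; lra.
Qed.

Lemma sum_scale n : \sum_(j < n) scale j = 4^-1 - 2 * scale n.
Proof.
elim: n => [|n IH]; first by rewrite big_ord0 /scale add0n; lra.
by rewrite big_ord_recr /= IH scaleS; lra.
Qed.

Lemma scale_small (e : R) : 0 < e -> exists j, scale j < e.
Proof.
move=> e0; exists (Num.bound e^-1).
rewrite /scale invf_plt ?posrE ?exprn_gt0//.
have : e^-1 < (Num.bound e^-1)%:R by apply: archi_boundP; rewrite invr_ge0 ltW.
move=> /lt_le_trans; apply.
rewrite -natrX ler_nat; apply: leq_trans (ltnW (ltn_expl _ (ltnSn 1))) _.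
by rewrite leq_exp2l // leq_addr.
Qed.

Lemma forecast_var_gt0 xi n : 0 < forecast_var xi n.
Proof. by rewrite /forecast_var. Qed.

Lemma cumvar_ge0 xi n : 0 <= cumvar xi n.
Proof. by apply: sumr_ge0 => k _; apply/ltW/forecast_var_gt0. Qed.

Lemma cumvarS xi n : cumvar xi n.+1 = cumvar xi n + forecast_var xi n.
Proof. by rewrite /cumvar big_ord_recr. Qed.

Lemma g_cumvar_gt0 xi n : 0 < g (cumvar xi n).
Proof. by apply: g_gt0; apply: cumvar_ge0. Qed.

Lemma scaled_varS xi n :
  scaled_var xi n.+1 = scaled_var xi n + forecast_var xi n / g (cumvar xi n.+1).
Proof. by rewrite /scaled_var big_ord_recr. Qed.

Lemma scaled_var_term_gt0 xi n : 0 < forecast_var xi n / g (cumvar xi n.+1).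
Proof. by rewrite divr_gt0 ?g_cumvar_gt0 ?forecast_var_gt0. Qed.

Lemma scaled_var_ge0 xi n : 0 <= scaled_var xi n.
Proof. by apply: sumr_ge0 => k _; apply/ltW/scaled_var_term_gt0. Qed.

Lemma norming_gt0 xi n : 0 < norming xi n.
Proof.
by rewrite mulr_gt0 ?g_cumvar_gt0// exprn_gt0//; have := scaled_var_ge0 xi n; lra.
Qed.

Lemma norming_incr xi n : norming xi n <= norming xi n.+1.
Proof.
have W0 := scaled_var_ge0 xi n; have w0 := scaled_var_term_gt0 xi n.
apply: ler_pM; first exact/ltW/g_cumvar_gt0.
- by rewrite exprn_ge0//; lra.
- apply: g_incr; first exact: cumvar_ge0.
  by rewrite cumvarS; have := forecast_var_gt0 xi n; lra.
- by rewrite scaled_varS lerXn2r ?nnegrE; lra.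
Qed.

Lemma energy_ge0 xi n : 0 <= energy xi n.
Proof. by rewrite divr_ge0 ?sqr_ge0 ?ltW ?norming_gt0. Qed.

Lemma energy0 xi : energy xi 0 = 0.
Proof. by rewrite /energy /surplus big_ord0 expr0n mul0r. Qed.

Lemma reserve_gt0 xi n : 0 < reserve xi n.
Proof. by rewrite invr_gt0; have := scaled_var_ge0 xi n; lra. Qed.

Lemma reserve0 xi : reserve xi 0 = 1.
Proof. by rewrite /reserve /scaled_var big_ord0 addr0 invr1. Qed.

(** With [w] the new term of [W], the fee is [w / (1 + W + w)^2], and
[1 / (1 + W) - 1 / (1 + W + w) = w / ((1 + W) (1 + W + w))]. *)
Lemma reserve_pays xi n :
  forecast_var xi n / norming xi n.+1 <= reserve xi n - reserve xi n.+1.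
Proof.
rewrite /reserve /norming.
have W0 := scaled_var_ge0 xi n; have w0 := scaled_var_term_gt0 xi n.
rewrite invfM mulrA scaled_varS.
set w := forecast_var xi n / _ in w0 *; set W := scaled_var xi n in W0 *.
have -> : (1 + W)^-1 - (1 + (W + w))^-1 = w / ((1 + W) * (1 + (W + w))).
  by field; rewrite !gt_eqF//; lra.
rewrite ler_pM2l // lef_pV2 ?posrE ?mulr_gt0 ?exprn_gt0//; try lra.
by rewrite expr2 ler_pM2r; lra.
Qed.

Lemma reserve_decr xi n : reserve xi n.+1 <= reserve xi n.
Proof.
have := reserve_pays xi n; have := norming_gt0 xi n.+1 => b0 H.
have : 0 <= forecast_var xi n / norming xi n.+1.
  by rewrite divr_ge0 ?ltW ?forecast_var_gt0.
by lra.
Qed.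

(** Capital gain, income and fee of holding one unit of the asset for one round. *)
Lemma unit_gain_ge xi n :
  energy xi n.+1 - energy xi n
  + energy xi n * (1 - norming xi n / norming xi n.+1)
  + (reserve xi n.+1 - reserve xi n) <= unit_gain xi n.
Proof.
have b0 := norming_gt0 xi n; have b1 := norming_gt0 xi n.+1.
have := reserve_pays xi n.
rewrite /unit_gain /energy.
have -> : surplus xi n.+1 = surplus xi n + (outcome_at xi n - forecast_mean xi n).
  by rewrite /surplus big_ord_recr.
set d := outcome_at xi n - _; set S := surplus xi n; set v := forecast_var xi n.
set p := norming xi n in b0 *; set q := norming xi n.+1 in b1 *.
suff -> : (S + d) ^+ 2 / q - S ^+ 2 / p + S ^+ 2 / p * (1 - p / q) =
   2 * S / q * d + q^-1 * (d ^+ 2 - v) + v / q by lra.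
by field; rewrite !gt_eqF.
Qed.

Lemma unit_gain_ge_energy xi n :
  (energy xi n.+1 - energy xi n) + (reserve xi n.+1 - reserve xi n) <= unit_gain xi n.
Proof.
apply: le_trans (unit_gain_ge xi n); rewrite lerD2r lerDl mulr_ge0 ?energy_ge0//.
by rewrite subr_ge0 ler_pdivrMr ?norming_gt0// mul1r norming_incr.
Qed.

Lemma stake_ge0 xi n : 0 <= stake xi n.
Proof.
apply: addr_ge0; first by rewrite invr_ge0.
by apply: sumr_ge0 => j _; rewrite mulr_ge0 // ltW ?scale_gt0.
Qed.

Lemma quad_bet_ge0 xi n : 0 <= stake xi n / norming xi n.+1.
Proof. by rewrite divr_ge0 ?stake_ge0 // ltW // norming_gt0. Qed.

Definition law_bet xi n : bet R :=
  Bet (stake xi n * (2 * surplus xi n / norming xi n.+1)) (NngNum (quad_bet_ge0 xi n)).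

Definition law_strategy : strategy R := strategy_of law_bet.

Lemma surplus_past xi xi' n :
  (forall k, (k < n)%N -> xi k = xi' k) -> surplus xi n = surplus xi' n.
Proof.
by move=> past; apply: eq_bigr => k _; rewrite /outcome_at /forecast_mean past.
Qed.

(** Since no outcome enters it, [norming xi n.+1] is already known when the bet of round
[n] is made. *)
Lemma norming_announced xi xi' n :
  (forall k, (k < n)%N -> announced (xi k) = announced (xi' k)) ->
  norming xi n = norming xi' n.
Proof.
move=> ann.
have eqA m : (m <= n)%N -> cumvar xi m = cumvar xi' m.
  move=> mn; apply: eq_bigr => k _.
  by rewrite /forecast_var ann // (leq_trans (ltn_ord k)).
rewrite /norming eqA // /scaled_var; congr (_ * (1 + _) ^+ 2).
by apply: eq_bigr => k _; rewrite /forecast_var ann // eqA // ltn_ord.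
Qed.

Lemma energy_past xi xi' n :
  (forall k, (k < n)%N -> xi k = xi' k) -> energy xi n = energy xi' n.
Proof.
move=> past; rewrite /energy (surplus_past past) (@norming_announced xi xi') //.
by move=> k kn; rewrite past.
Qed.

Lemma stake_past xi xi' n :
  (forall k, (k < n)%N -> xi k = xi' k) -> stake xi n = stake xi' n.
Proof.
move=> past; rewrite /stake; congr (_ + _); apply: eq_bigr => j _; congr (_ * (nat_of_bool _)%:R).
apply: eq_holding => k kn; apply: energy_past => i ik.
by apply: past; exact: leq_trans ik kn.
Qed.

Lemma law_bet_predictable : predictable law_bet.
Proof.
move=> xi xi' n past ann.
have Eb : norming xi n.+1 = norming xi' n.+1.
  apply: norming_announced => k; rewrite ltnS leq_eqVlt => /orP[/eqP -> //|kn].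
  by rewrite past.
rewrite /law_bet; congr Bet; first by rewrite Eb (stake_past past) (surplus_past past).
by apply/val_inj; rewrite /= Eb (stake_past past).
Qed.

Lemma law_capital xi n :
  capital law_strategy xi n = \sum_(k < n) stake xi k * unit_gain xi k.
Proof.
rewrite capital_sum; apply: eq_bigr => k _.
rewrite bet_at_strategy_of; last exact: law_bet_predictable.
by rewrite /= /unit_gain; ring.
Qed.

Definition level_gain xi j n : R :=
  \sum_(k < n) (holding (energy xi) j (scale j) k)%:R * unit_gain xi k.

Lemma law_capital_split xi n :
  capital law_strategy xi n =
  2^-1 * \sum_(k < n) unit_gain xi k + \sum_(j < n) scale j * level_gain xi j n.
Proof.
rewrite law_capital /stake.
under eq_bigr do rewrite mulrDl.
rewrite big_split /= -mulr_sumr; congr (_ + _).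
under [RHS]eq_bigr do rewrite mulr_sumr.
rewrite exchange_big /=; apply: eq_bigr => k _.
rewrite mulr_suml.
(* The levels between [k.+1] and [n] are not yet trading in round [k]. *)
rewrite (big_ord_widen n (fun j => scale j * (holding (energy xi) j (scale j) k)%:R
   * unit_gain xi k)) // big_mkcond /=.
apply: eq_bigr => j _; rewrite mulrA; case: ifP => // /negbT.
by rewrite -leqNgt => kj; rewrite holding_start // mulr0 mul0r.
Qed.

Lemma total_gain_ge xi n :
  \sum_(k < n) energy xi k * (1 - norming xi k / norming xi k.+1) - 1
  <= \sum_(k < n) unit_gain xi k.
Proof.
apply: (@le_trans _ _ (energy xi n + (reserve xi n - 1) +
    \sum_(k < n) energy xi k * (1 - norming xi k / norming xi k.+1))).
  by have := energy_ge0 xi n; have := reserve_gt0 xi n; lra.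
elim: n => [|n IH]; first by rewrite !big_ord0 energy0 reserve0; lra.
by rewrite !big_ord_recr /=; have := unit_gain_ge xi n; lra.
Qed.

Lemma total_gain_geN1 xi n : -1 <= \sum_(k < n) unit_gain xi k.
Proof.
apply: le_trans (total_gain_ge xi n); rewrite lerBrDr addNr sumr_ge0 // => k _.
rewrite mulr_ge0 ?energy_ge0 // subr_ge0 ler_pdivrMr ?norming_gt0 // mul1r.
exact: norming_incr.
Qed.

Lemma level_gain_ge xi j n :
  scale j * (sales (energy xi) j (scale j) n)%:R - 2 <= level_gain xi j n.
Proof.
have := @upcrossing_gain _ (energy xi) j (scale j) (unit_gain xi) (reserve xi) n
  (scale_gt0 j) (reserve_decr xi) (unit_gain_ge_energy xi).
apply: le_trans; rewrite reserve0.
have := energy_ge0 xi n; have := reserve_gt0 xi n; have := scale_le j.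
by case: holding; lra.
Qed.

Lemma level_gain_geN2 xi j n : -2 <= level_gain xi j n.
Proof.
apply: le_trans (level_gain_ge xi j n).
by rewrite lerBrDr addNr mulr_ge0 // ltW ?scale_gt0.
Qed.

Lemma sum_level_gain_ge xi n (P : pred 'I_n) :
  - 2^-1 <= \sum_(j < n | P j) scale j * level_gain xi j n.
Proof.
apply: (@le_trans _ _ (\sum_(j < n) - 2 * scale j)).
  by rewrite -mulr_sumr sum_scale; have := scale_gt0 n; lra.
rewrite [leRHS]big_mkcond /=; apply: ler_sum => j _.
have s0 := scale_gt0 j.
case: ifP => _; last by lra.
by rewrite mulrC ler_pM2l // level_gain_geN2.
Qed.

Lemma law_capital_geN1 xi n : -1 <= capital law_strategy xi n.
Proof.
rewrite law_capital_split.
by have := total_gain_geN1 xi n; have /= := sum_level_gain_ge xi (n := n) xpredT; lra.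
Qed.

(** * Paths of bounded capital *)

Section bounded_capital.
Variables (xi : game_path R) (B : R).
Hypothesis capB : forall n, capital law_strategy xi n <= B.

Lemma bounded_total_gain n : \sum_(k < n) unit_gain xi k <= 2 * B + 1.
Proof.
have := capB n; rewrite law_capital_split.
by have /= := sum_level_gain_ge xi (n := n) xpredT; lra.
Qed.

(** The other parts of the mixture lose at most 1 in total, so a bound on the whole bounds
each part. *)
Lemma bounded_level_gain j n : (j < n)%N -> scale j * level_gain xi j n <= B + 1.
Proof.
move=> jn; have := capB n; rewrite law_capital_split [X in _ + X](bigD1 (Ordinal jn)) //=.
have := total_gain_geN1 xi n.
have /= := sum_level_gain_ge xi (fun i => i != Ordinal jn).
lra.
Qed.

Lemma bounded_sales j :
  exists C, forall n, scale j * (sales (energy xi) j (scale j) n)%:R <= C.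
Proof.
have s0 := scale_gt0 j.
exists ((B + 1) / scale j + 2) => n.
(* [level_gain] enters the capital from time [j.+1] on, hence the shift. *)
apply: (@le_trans _ _ (scale j * (sales (energy xi) j (scale j) (n + j.+1))%:R)).
  by rewrite ler_pM2l // ler_nat sales_mono // leq_addr.
rewrite -lerBlDr; apply: le_trans (level_gain_ge _ _ _) _.
by rewrite ler_pdivlMr // mulrC bounded_level_gain // addnS ltnS leq_addl.
Qed.

Hypothesis norming_unbounded : forall M, exists n, M <= norming xi n.

Lemma energy_eventually_small j :
  exists m, forall n, (m <= n)%N -> energy xi n < 2 * scale j.
Proof.
apply: contrapT => nsmall; have s0 := scale_gt0 j.
have high m : exists2 n, (m <= n)%N & 2 * scale j <= energy xi n.
  apply: contrapT => nh; apply: nsmall; exists m => n mn.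
  by rewrite ltNge; apply/negP => Un; apply: nh; exists n.
have low : forall m, exists2 n, (m <= n)%N & energy xi n <= scale j.
  apply: (@bounded_income_low _ (norming xi) _ _ _ _ _ (2 * B + 2)) => //.
  - exact: norming_gt0.
  - exact: norming_incr.
  - exact: energy_ge0.
  by move=> n; have := total_gain_ge xi n; have := bounded_total_gain n; lra.
have [C HC] := bounded_sales j.
have [n] := sales_unbounded j s0 low high (C / scale j).
by rewrite ltr_pdivrMr // mulrC ltNge HC.
Qed.

End bounded_capital.

Lemma cumvar_unbounded xi : (\sum_(0 <= n <oo) (forecast_var xi n)%:E = +oo)%E ->
  forall M, exists n, M < cumvar xi n.
Proof.
move=> sumv M; apply: contrapT => nM.
suff : (\sum_(0 <= n <oo) (forecast_var xi n)%:E <= M%:E)%E by rewrite sumv.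
apply: lime_le.
  by apply: is_cvg_nneseries => n _ _; rewrite lee_fin ltW ?forecast_var_gt0.
apply: nearW => n; rewrite sumEFin lee_fin big_mkord leNgt.
by apply/negP => Mn; apply: nM; exists n.
Qed.

Lemma scaled_var_bounded xi :
  (\sum_(0 <= n <oo) (forecast_var xi n / g (cumvar xi n.+1))%:E < +oo)%E ->
  exists C, forall n, scaled_var xi n <= C.
Proof.
move=> fin.
have partial n : ((scaled_var xi n)%:E <=
    \sum_(0 <= n <oo) (forecast_var xi n / g (cumvar xi n.+1))%:E)%E.
  rewrite /scaled_var -(big_mkord xpredT (fun k => forecast_var xi k / g (cumvar xi k.+1))).
  rewrite -sumEFin; apply: nneseries_lim_ge => k _ _.
  by rewrite lee_fin ltW ?scaled_var_term_gt0.
move: fin partial; case: (\big[_/_]_(_ <= _ <oo) _)%E => [r||] // _ partial.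
  by exists r => n; rewrite -lee_fin.
by have := partial 0%N.
Qed.

(** With [C] a bound on [W_n], the square of the normalized sum is
[U_n (1 + W_n)^2 <= U_n (1 + C)^2]. *)
Lemma strong_law_of_bounded_capital xi (B : R) : g x @[x --> +oo] --> +oo ->
  (forall n, capital law_strategy xi n <= B) ->
  (\sum_(0 <= n <oo) (forecast_var xi n)%:E = +oo)%E ->
  (\sum_(0 <= n <oo) (forecast_var xi n / g (cumvar xi n.+1))%:E < +oo)%E ->
  surplus xi n / Num.sqrt (g (cumvar xi n)) @[n --> \oo] --> 0.
Proof.
move=> g_pinfty capB sumv sumw.
have norming_unb M : exists n, M <= norming xi n.
  have /cvgryPge /(_ M) [a [_ ga]] := g_pinfty.
  have [n Hn] := cumvar_unbounded sumv a.
  exists n; apply: le_trans (ga _ Hn) _.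
  apply: ler_peMr; first exact/ltW/g_cumvar_gt0.
  by apply: exprn_ege1; have := scaled_var_ge0 xi n; lra.
have [C HC] := scaled_var_bounded sumw; clear sumv sumw.
have C0 : 0 <= C by apply: le_trans (HC 0%N); exact: scaled_var_ge0.
apply/cvgr0Pnorm_lt => e e0.
have C1 : 0 < (1 + C) ^+ 2 by apply: exprn_gt0; lra.
have [|j Hj] := scale_small (e := e ^+ 2 / (2 * (1 + C) ^+ 2)).
  by apply: divr_gt0; [exact: exprn_gt0 | exact: mulr_gt0].
have [m Hm] := energy_eventually_small capB norming_unb j.
exists m => // n /= mn.
have gA := g_cumvar_gt0 xi n.
rewrite -(ltr_pXn2r (n := 2)) ?nnegrE ?(ltW e0) // -normrX ger0_norm ?sqr_ge0 //.
rewrite expr_div_n sqr_sqrtr ?ltW //.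
have W0 := scaled_var_ge0 xi n.
have W1 : 0 < 1 + scaled_var xi n by lra.
have -> : surplus xi n ^+ 2 / g (cumvar xi n) = energy xi n * (1 + scaled_var xi n) ^+ 2.
  by rewrite /energy /norming; field; rewrite !gt_eqF.
apply: (@le_lt_trans _ _ (2 * scale j * (1 + C) ^+ 2)).
  apply: ler_pM; rewrite ?energy_ge0 ?exprn_ge0 ?(ltW W1) ?(ltW (Hm _ mn)) //.
  by rewrite lerXn2r ?nnegrE ?lerD2l ?HC //; lra.
by move: Hj; rewrite ltr_pdivlMr ?mulr_gt0 //; set s := scale j; nra.
Qed.

End strong_law.

Theorem corollary4p5 (R : realType) (g : R -> R)
  (g_gt0 : forall x : R, 0 <= x -> 0 < g x)
  (g_incr : forall x y : R, 0 <= x -> x <= y -> g x <= g y)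
  (g_pinfty : g x @[x --> +oo] --> +oo) :
  can_force (event_impl
    [set xi : game_path R |
       (\sum_(0 <= n <oo) (forecast_var xi n)%:E = +oo)%E /\
       (\sum_(0 <= n <oo) (forecast_var xi n / g (cumvar xi n.+1))%:E < +oo)%E]
    [set xi : game_path R |
       (\sum_(k < n) (outcome_at xi k - forecast_mean xi k)) / Num.sqrt (g (cumvar xi n))
         @[n --> \oo] --> 0]).
Proof.
exists (law_strategy g_gt0); split; first exact: law_capital_geN1.
move=> xi nE; apply: limn_esup_unbounded => B; apply: contrapT => nB.
have capB n : capital (law_strategy g_gt0) xi n <= B.
  by rewrite leNgt; apply/negP => Bn; apply: nB; exists n.
apply: nE; rewrite /event_impl /=.
have [[sumv sumw]|nE] := pselect ((\sum_(0 <= n <oo) (forecast_var xi n)%:E = +oo)%E /\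
    (\sum_(0 <= n <oo) (forecast_var xi n / g (cumvar xi n.+1))%:E < +oo)%E).
  by right; exact: strong_law_of_bounded_capital g_incr _ _ g_pinfty capB sumv sumw.
by left.
Qed.
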